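(* Let $f=x^6+y^6+x^4zt+z^3$, let $V_1=\{(x,y,z,t)\in\mathbb{C}^4\mid f(x,y,z,t)=0\}$, let $V_2=\{(0,0,0,t)\mid t\in\mathbb{C}\}\subset\mathbb{C}^4$, which is the singular locus of $V_1$, and let $$V_3=\{(0,0,0,t)\in\mathbb{C}^4\mid 4t^3+27=0\}\subset V_2 .$$ Then at every point of $V_3$ the pair $(V_1\setminus V_2,\ V_2)$ satisfies neither Whitney's condition (a) nor Whitney's condition (b).
   Context: Let $X$ and $Y$ be two smooth (here: complex) submanifolds of $\mathbb{C}^n$ with $X\cap Y=\emptyset$ and $Y$ contained in the closure of $X$, and let $p\in Y$. Tangent spaces are viewed as linear subspaces of $\mathbb{C}^n$, and their limits are taken in the Grassmannian. Whitney's condition (a): the pair $(X,Y)$ satisfies condition (a) at $p$ if for any sequence $p_\epsilon\in X$ with $p_\epsilon\to p$ and $T_{p_\epsilon}X\to T$, one has $T_pY\subset T$. Whitney's condition (b): the pair $(X,Y)$ satisfies condition (b) at $p$ if for any sequences $p_\epsilon\in X$ and $q_\epsilon\in Y$ such that $p_\epsilon\to p$, $q_\epsilon\to p$, $T_{p_\epsilon}X\to T$, and the lines $\overline{p_\epsilon q_\epsilon}$ (the line through $p_\epsilon$ and $q_\epsilon$, considered through its direction) converge to a line $\ell$ in the projective space $\mathbb{P}^{n-1}$, one has $\ell\subset T$. *)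

(* Defs.v *)
From HB Require Import structures.
From mathcomp Require Import all_boot all_order all_algebra complex.
From mathcomp Require Import all_classical all_reals all_analysis.
Import Order.TTheory GRing.Theory Num.Theory numFieldNormedType.Exports.

Set Implicit Arguments.
Unset Strict Implicit.
Unset Printing Implicit Defensive.

Local Open Scope classical_set_scope.
Local Open Scope ring_scope.

(* Giving R[i] as a numClosedFieldType behind a constant lets the topology and
   the norm of a numFieldType be inferred on it; in particular differentiability
   of maps 'rV[Cplx R]_n -> 'rV[Cplx R]_k is complex differentiability. *)
Definition Cplx (R : realType) : numClosedFieldType := R[i].

Section Grassmannian.
Variables (K : numFieldType) (d n : nat).

Definition frame := [set B : 'M[K]_(d, n) | row_free B].

Record grassmannian := Grassmannian {
  gr_space :> {vspace 'rV[K]_n};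
  gr_dim : \dim gr_space == d }.

HB.instance Definition _ := [isSub for gr_space].
HB.instance Definition _ := [Choice of grassmannian by <:].

Definition row_span (B : 'M[K]_(d, n)) : {vspace 'rV[K]_n} :=
  <<[tuple row i B | i < d]>>%VS.

Lemma dim_row_span (B : frame) : \dim (row_span (val B)) == d.
Proof.
have /set_mem /= Bfree := valP B.
suff /eqP -> : free [tuple row i (val B) | i < d] by rewrite size_tuple.
apply/freeP => c c0 i; apply/eqP.
have : (\row_j c j) *m val B = 0.
  rewrite mulmx_sum_row -[RHS]c0; apply: eq_bigr => j _.
  by rewrite mxE (nth_map j) ?size_enum_ord // nth_ord_enum.
rewrite -(mul0mx 1 (val B)) => /(row_free_inj Bfree)/rowP/(_ i).
by rewrite !mxE => ->.
Qed.

Definition gr_span (B : frame) : grassmannian := Grassmannian (dim_row_span B).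

(* The topology of the Grassmannian is the quotient topology along gr_span of
   the subspace topology on the frames. *)
Definition gr_open (A : set grassmannian) := open (gr_span @^-1` A).

Lemma gr_openT : gr_open setT.
Proof. by rewrite /gr_open preimage_setT; exact: openT. Qed.

Lemma gr_openI : setI_closed gr_open.
Proof. by move=> A B; exact: openI. Qed.

Lemma gr_open_bigcup (I : Type) (A : I -> set grassmannian) :
  (forall i, gr_open (A i)) -> gr_open (\bigcup_i A i).
Proof. by move=> oA; apply: bigcup_open => i _; exact: oA. Qed.

HB.instance Definition _ :=
  isOpenTopological.Build grassmannian gr_openT gr_openI gr_open_bigcup.

End Grassmannian.

Arguments frame : clear implicits.

Section Whitney.
Variables (R : realType) (n : nat).
Local Notation C := (Cplx R).
Implicit Types (X Y : set 'rV[C]_n) (p : 'rV[C]_n).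

(* Near p, the set X is the zero locus in the open set U of a holomorphic map
   with values in C^k whose differential is onto at every point of U. *)
Definition local_equation X p k (U : set 'rV[C]_n)
    (g : 'rV[C]_n -> 'rV[C]_k) :=
  [/\ open U, U p, X `&` U = U `&` [set q | g q = 0]
    & forall q, U q -> differentiable g q /\ range ('d g q) = setT].

Definition complex_submanifold d X :=
  forall p, X p -> exists k U (g : 'rV[C]_n -> 'rV[C]_k),
    (d + k)%N = n /\ local_equation X p U g.

(* T = T_p X, the kernel of the differential at p of a local equation of X. *)
Definition is_tangent_space X p (T : {vspace 'rV[C]_n}) :=
  exists k U (g : 'rV[C]_n -> 'rV[C]_k),
    local_equation X p U g /\ forall v, v \in T <-> 'd g p v = 0.

Definition whitney_pair d e X Y :=
  [/\ complex_submanifold d X, complex_submanifold e Y,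
      X `&` Y = set0 & Y `<=` closure X].

(* In the two conditions d and e are the dimensions of X and Y. *)
Definition whitney_a d e X Y p :=
  forall (p_ : nat -> 'rV[C]_n) (T_ : nat -> grassmannian C d n)
         (T : grassmannian C d n) (TpY : grassmannian C e n),
    (forall k, X (p_ k)) -> p_ @ \oo --> p ->
    (forall k, is_tangent_space X (p_ k) (T_ k)) -> T_ @ \oo --> T ->
    is_tangent_space Y p TpY ->
    (TpY <= T)%VS.

(* The projective space of lines through 0 in C^n is grassmannian C 1 n. *)
Definition whitney_b d X Y p :=
  forall (p_ q_ : nat -> 'rV[C]_n) (T_ : nat -> grassmannian C d n)
         (T : grassmannian C d n) (l_ : nat -> grassmannian C 1 n)
         (l : grassmannian C 1 n),
    (forall k, X (p_ k)) -> (forall k, Y (q_ k)) ->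
    p_ @ \oo --> p -> q_ @ \oo --> p ->
    (forall k, is_tangent_space X (p_ k) (T_ k)) -> T_ @ \oo --> T ->
    (forall k, l_ k = <[p_ k - q_ k]>%VS :> {vspace 'rV[C]_n}) ->
    l_ @ \oo --> l ->
    (l <= T)%VS.

(* The singular locus of the hypersurface h = 0 by the Jacobian criterion, for a
   reduced polynomial h; the polynomial f below is reduced. *)
Definition singular_locus (h : 'rV[C]_n -> C) : set 'rV[C]_n :=
  [set p | h p = 0 /\ forall i, 'D_(delta_mx 0 i) h p = 0].

End Whitney.

Section Example.
Variable R : realType.
Local Notation C := (Cplx R).

Definition vec4 (x y z t : C) : 'rV[C]_4 :=
  \row_(i < 4) [tuple x; y; z; t]`_i.

Definition f (v : 'rV[C]_4) : C :=
  let x := v 0 0 in let y := v 0 1 in let z := v 0 2 in let t := v 0 3 in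
  x ^+ 6 + y ^+ 6 + x ^+ 4 * z * t + z ^+ 3.

Definition V1 : set 'rV[C]_4 := [set v | f v = 0].

Definition V2 : set 'rV[C]_4 := [set vec4 0 0 0 t | t in setT].

Definition V3 : set 'rV[C]_4 :=
  [set vec4 0 0 0 t | t in [set t | 4 * t ^+ 3 + 27 = 0]].

End Example.

Arguments f : clear implicits.
Arguments V1 : clear implicits.
Arguments V2 : clear implicits.
Arguments V3 : clear implicits.

(* Main.v *)
(* With z = w x^2 and y = 0, f becomes x^6 (1 + w t + w^3), and V3 is where the
   cubic 1 + w t + w^3 has a double root w. Along the curve (x, 0, w x^2, t)
   with this w, the derivatives f_x, f_y, f_z all vanish while f_t = w x^6 does
   not, so the tangent space of V1 is constantly the hyperplane dt = 0. This
   hyperplane does not contain the t-axis, which refutes (a); the secants to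
   (0, 0, 0, t + x) tend to the line spanned by (1, 0, 0, -1), which refutes
   (b). *)
Require Import Defs.
From HB Require Import structures.
From mathcomp Require Import all_boot all_order all_algebra complex.
From mathcomp Require Import all_classical all_reals all_analysis.
From mathcomp Require Import ring.
Import Order.TTheory GRing.Theory Num.Theory numFieldNormedType.Exports.

Set Implicit Arguments.
Unset Strict Implicit.
Unset Printing Implicit Defensive.

Local Open Scope classical_set_scope.
Local Open Scope ring_scope.

(** * Convergence of matrices, frames and subspaces *)

Lemma cvg_mx (K : numFieldType) m n (u : nat -> 'M[K]_(m, n)) (M : 'M[K]_(m, n)) :
  (forall i j, u k i j @[k --> \oo] --> M i j) -> u @ \oo --> M.
Proof.
move=> uM A [P MP sPA].
(* There are finitely many entries, so the entrywise conditions hold simultaneously for all large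
   [k]. *)
have : \forall k \near \oo, forall ij : 'I_m * 'I_n, P ij.1 ij.2 (u k ij.1 ij.2).
  by apply: filter_forall => -[i j] /=; apply: uM; exact: MP.
by apply: filterS => k Pk; apply: sPA => i j; exact: (Pk (i, j)).
Qed.

(** In the order of [R[i]] a positive radius has zero imaginary part and positive real part, so the
    Archimedean property of [R] suffices. *)
Lemma cvg_invSn_Cplx (R : realType) :
  (k.+1%:R^-1 : Cplx R) @[k --> \oo] --> (0 : Cplx R).
Proof.
apply/cvgr0Pnorm_lt => -[a b]; rewrite ltcE/= => /andP[/eqP b0 a0].
have := near_infty_natSinv_lt (PosNum a0); apply: filterS => k /= ka.
rewrite ger0_norm ?invr_ge0 ?ler0n//.
have -> : k.+1%:R^-1 = (k.+1%:R^-1 : R)%:C%C :> Cplx R.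
  by rewrite fmorphV/= rmorph_nat.
by rewrite ltcE/= b0 eqxx.
Qed.

(** Openness in the Grassmannian is defined by pulling back along [gr_span]. *)
Lemma gr_span_continuous (K : numFieldType) d n :
  continuous (@gr_span K d n).
Proof. by apply/continuousP => A. Qed.

(** Frames carry the subspace topology: their open sets are traces of open sets of matrices. *)
Lemma cvg_frame (K : numFieldType) d n (u : nat -> frame K d n) (B : frame K d n) :
  val (u k) @[k --> \oo] --> val B -> u @ \oo --> B.
Proof.
move=> uB A [_ [[D Do <-] /= DB] sDA].
have Du : \forall k \near \oo, D (val (u k)).
  by apply: uB; exact: open_nbhs_nbhs.
by change (\forall k \near \oo, A (u k)); apply: filterS Du => k; exact: sDA.
Qed.

(** * Row spans and membership in coordinate subspaces *)

Lemma mem_row_span (K : numFieldType) d n (B : 'M[K]_(d, n)) (v : 'rV[K]_n) :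
  v \in row_span B <-> exists u, v = u *m B.
Proof.
split=> [/coord_span ->|[u ->]]; last first.
  rewrite mulmx_sum_row; apply: memv_suml => i _.
  by apply/memvZ/memv_span/mapP; exists i; rewrite ?mem_enum.
exists (\row_i coord [tuple row i B | i < d] i v).
rewrite mulmx_sum_row; apply: eq_bigr => i _; rewrite mxE.
by rewrite (nth_map i) ?size_enum_ord // nth_ord_enum.
Qed.

Lemma row_free_mx10 (K : fieldType) m n :
  row_free (row_mx 1%:M 0 : 'M[K]_(m, m + n)).
Proof.
apply/row_freeP; exists (col_mx 1%:M 0).
by rewrite mul_row_col mulmx1 mul0mx addr0.
Qed.

Lemma row_free_mx01 (K : fieldType) m n :
  row_free (row_mx 0 1%:M : 'M[K]_(n, m + n)).
Proof.
apply/row_freeP; exists (col_mx 0 1%:M).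
by rewrite mul_row_col mulmx1 mul0mx add0r.
Qed.

Lemma mem_row_span_mx10 (K : numFieldType) m n (v : 'rV[K]_(m + n)) :
  v \in row_span (row_mx 1%:M 0 : 'M[K]_(m, m + n)) <-> rsubmx v = 0.
Proof.
rewrite mem_row_span; split=> [[u ->]|v0].
  by rewrite mul_mx_row mulmx0 row_mxKr.
exists (lsubmx v); rewrite mul_mx_row mulmx1 mulmx0 -v0; exact/esym/hsubmxK.
Qed.

Lemma mem_row_span_mx01 (K : numFieldType) m n (v : 'rV[K]_(m + n)) :
  v \in row_span (row_mx 0 1%:M : 'M[K]_(n, m + n)) <-> lsubmx v = 0.
Proof.
rewrite mem_row_span; split=> [[u ->]|v0].
  by rewrite mul_mx_row mulmx0 row_mxKl.
exists (rsubmx v); rewrite mul_mx_row mulmx1 mulmx0 -v0; exact/esym/hsubmxK.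
Qed.

Lemma row_span_rV (K : numFieldType) n (w : 'rV[K]_n) : row_span w = <[w]>%VS.
Proof.
apply/vspaceP => v; apply/idP/idP => [/mem_row_span[u ->]|/vlineP[k ->]].
  by rewrite [u]mx11_scalar mul_scalar_mx memvZ ?memv_line.
by apply/mem_row_span; exists k%:M; rewrite mul_scalar_mx.
Qed.

(** * Topology and differentials of coordinate functions *)

Lemma cvg_row4 (K : numFieldType) (x_ y_ z_ t_ : nat -> K) (x y z t : K) :
  x_ @ \oo --> x -> y_ @ \oo --> y -> z_ @ \oo --> z -> t_ @ \oo --> t ->
  (\row_(i < 4) [tuple x_ k; y_ k; z_ k; t_ k]`_i) @[k --> \oo] -->
  \row_(i < 4) [tuple x; y; z; t]`_i.
Proof.
move=> hx hy hz ht; apply: cvg_mx => i j; rewrite mxE.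
under eq_fun do rewrite mxE.
by case: j => -[|[|[|[|//]]]] hj /=; [exact: hx|exact: hy|exact: hz|exact: ht].
Qed.

Lemma closed_coord_eq0 (K : numFieldType) m n i j :
  closed [set M : 'M[K]_(m, n) | M i j = 0].
Proof.
apply: (@closed_comp _ _ (fun M : 'M[K]_(m, n) => M i j) [set 0]).
  by move=> M _; exact: coord_continuous.
exact/accessible_closed_set1/hausdorff_accessible/norm_hausdorff.
Qed.

Lemma is_diff_lin (K : numFieldType) (V W : normedModType K) (g : {linear V -> W})
  (p : V) : continuous g -> is_diff p g g.
Proof.
by move=> cg; apply: DiffDef; [exact: linear_differentiable|exact: diff_lin].
Qed.

Lemma is_diff_coord (K : numFieldType) m n (M : 'M[K]_(m, n)) i j :
  is_diff M (fun N : 'M[K]_(m, n) => N i j : K^o) (fun N => N i j).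
Proof.
have lin : linear (fun N : 'M[K]_(m, n) => N i j : K^o).
  by move=> a u v; rewrite !mxE.
pose c : {linear 'M[K]_(m, n) -> K^o} :=
  HB.pack (fun N : 'M[K]_(m, n) => N i j : K^o)
    (GRing.isLinear.Build K 'M[K]_(m, n) K^o _ _ lin).
exact/(@is_diff_lin _ _ _ c)/coord_continuous.
Qed.

(** Coordinates are abstract functions here, so that the sum, product and power rules apply as they
    stand. *)
Lemma is_diff_f_poly (K : numFieldType) (V : normedModType K) (p : V)
    (x y z t dx dy dz dt : V -> K) :
  is_diff p x dx -> is_diff p y dy -> is_diff p z dz -> is_diff p t dt ->
  is_diff p (x ^+ 6 + y ^+ 6 + x ^+ 4 * z * t + z ^+ 3)
    (fun v => (6 * x p ^+ 5 + 4 * x p ^+ 3 * z p * t p) * dx v +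
      6 * y p ^+ 5 * dy v + (x p ^+ 4 * t p + 3 * z p ^+ 2) * dz v +
      x p ^+ 4 * z p * dt v).
Proof.
move=> hx hy hz ht.
(* [is_diffX n] differentiates the power [n.+1], whence 3, 5 and 2 for the exponents 4, 6 and 3. *)
have hm := is_diffM (is_diffM (is_diffX 3 hx) hz) ht.
have h := is_diffD (is_diffD (is_diffD (is_diffX 5 hx) (is_diffX 5 hy)) hm)
  (is_diffX 2 hz).
apply: (is_diff_eq h); apply/funext => v.
by rewrite !fctE/= /GRing.scale/=; ring.
Qed.

(** * The gradient of [f] and its zeros *)

Section Example.
Variable R : realType.
Local Notation C := (Cplx R).
Implicit Types (p v : 'rV[C]_4) (x y z t : C).

(** A product of equations instead of a conjunction lets [rewrite] use all four as one multirule. *)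
Lemma vec4E x y z t : (vec4 x y z t 0 0 = x) * (vec4 x y z t 0 1 = y) *
  (vec4 x y z t 0 2 = z) * (vec4 x y z t 0 3 = t).
Proof. by rewrite !mxE. Qed.

Lemma vec4_eta v : v = vec4 (v 0 0) (v 0 1) (v 0 2) (v 0 3).
Proof.
apply/rowP => -[[|[|[|[|//]]]] hi]; rewrite mxE/=; congr (v 0 _);
  exact: val_inj.
Qed.

Lemma cvg_vec4 (x_ y_ z_ t_ : nat -> C) x y z t :
  x_ @ \oo --> x -> y_ @ \oo --> y -> z_ @ \oo --> z -> t_ @ \oo --> t ->
  vec4 (x_ k) (y_ k) (z_ k) (t_ k) @[k --> \oo] --> vec4 x y z t.
Proof. exact: cvg_row4. Qed.

Definition df p v : C :=
  (6 * p 0 0 ^+ 5 + 4 * p 0 0 ^+ 3 * p 0 2 * p 0 3) * v 0 0 +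
  6 * p 0 1 ^+ 5 * v 0 1 + (p 0 0 ^+ 4 * p 0 3 + 3 * p 0 2 ^+ 2) * v 0 2 +
  p 0 0 ^+ 4 * p 0 2 * v 0 3.

Lemma is_diff_f p : is_diff p (f R) (df p).
Proof.
exact: (is_diff_f_poly (is_diff_coord p 0 0) (is_diff_coord p 0 1)
  (is_diff_coord p 0 2) (is_diff_coord p 0 3)).
Qed.

Lemma dfZ p a v : df p (a *: v) = a * df p v.
Proof. by rewrite /df !mxE; ring. Qed.

Lemma V2P p : V2 R p <-> [/\ p 0 0 = 0, p 0 1 = 0 & p 0 2 = 0].
Proof.
split=> [[t _ <-]|[p0 p1 p2]]; first by rewrite !vec4E.
by exists (p 0 3) => //; rewrite [RHS]vec4_eta p0 p1 p2.
Qed.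

(** The y-derivative forces y = 0. If x = 0, the z-derivative 3 z^2 gives z = 0. If x is nonzero,
    the t-derivative x^4 z gives z = 0, and then the x-derivative is 6 x^5, a contradiction. *)
Lemma df_delta_eq0 p :
  (forall i, df p (delta_mx 0 i) = 0) <-> V2 R p.
Proof.
rewrite V2P; split=> [H|[p0 p1 p2] i]; last first.
  by rewrite /df p0 p1 p2 !expr0n/= !(mulr0, mul0r, addr0).
have := H 0; have := H 1; have := H 2; have := H 3.
rewrite /df !mxE/= !(mulr0, mulr1, addr0, add0r) => h3 h2 h1 h0.
have p1 : p 0 1 = 0.
  by move/eqP: h1; rewrite mulf_eq0 pnatr_eq0/= expf_eq0 => /eqP.
have [p0|p0] := eqVneq (p 0 0) 0.
  split=> //; move/eqP: h2; rewrite p0 expr0n mul0r add0r mulf_eq0 pnatr_eq0/=.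
  by rewrite expf_eq0 => /eqP.
have p2 : p 0 2 = 0.
  by move/eqP: h3; rewrite mulf_eq0 expf_eq0 (negPf p0)/= => /eqP.
move/eqP: h0; rewrite p2 mulr0 mul0r addr0 mulf_eq0 pnatr_eq0/= expf_eq0/=.
by rewrite (negPf p0).
Qed.

Lemma V2_sub_V1 : V2 R `<=` V1 R.
Proof.
by move=> _ [t _ <-]; rewrite /V1/= /f !vec4E !expr0n/= !(mulr0, mul0r, addr0).
Qed.

Lemma V2_singular_locus : V2 R = singular_locus (f R).
Proof.
have dE p v : 'D_v (f R) p = df p v.
  have h := is_diff_f p.
  by rewrite deriveE; [rewrite diff_val|exact: ex_diff].
apply/seteqP; split=> p.
  move=> hp; split; first exact: V2_sub_V1.
  by move=> i; rewrite dE; move: i; apply/df_delta_eq0.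
by move=> [_ hp]; apply/df_delta_eq0 => i; rewrite -dE.
Qed.

(** * Local equations, and the pair of submanifolds *)

Lemma closed_V2 : closed (V2 R).
Proof.
have -> : V2 R = [set p : 'rV[C]_4 | p 0 0 = 0] `&` [set p | p 0 1 = 0] `&`
    [set p | p 0 2 = 0].
  by apply/seteqP; split=> p; [case/V2P|case=> -[*]; apply/V2P].
by do 2?[apply: closedI]; exact: closed_coord_eq0.
Qed.

(** Values are 1 x 1 matrices because [local_equation] expects row vectors. *)
Definition f_row (q : 'rV[C]_4) : 'rV[C]_1 := f R q *: const_mx 1.

Lemma is_diff_f_row p : is_diff p f_row (fun v => df p v *: const_mx 1).
Proof. exact: is_diff_comp (is_diff_f p) (is_diff_scalel _ _). Qed.

Lemma scale_const_mx1_eq0 (a : C) : a *: (const_mx 1 : 'rV[C]_1) = 0 <-> a = 0.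
Proof.
split=> [/rowP/(_ 0)|->]; last by rewrite scale0r.
by rewrite !mxE mulr1.
Qed.

(** Off the closed set [V2] the gradient is nonzero, and a nonzero linear form is onto. *)
Lemma local_equation_V1 p : ~ V2 R p ->
  local_equation (V1 R `\` V2 R) p (~` V2 R) f_row.
Proof.
move=> hp; split => //.
- exact/closed_openC/closed_V2.
- apply/seteqP; split=> q [].
    by move=> [q1 q2] _; split=> //=; apply/scale_const_mx1_eq0.
  by move=> q2 /scale_const_mx1_eq0.
move=> q hq; have h := is_diff_f_row q; split; first exact: ex_diff.
have [v dv] : exists v, df q v != 0.
  apply: contrapT => hv; apply/hq/df_delta_eq0 => i.
  by apply: contrapT => /eqP hi; apply: hv; exists (delta_mx 0 i).
apply/seteqP; split=> // u _; exists ((u 0 0 / df q v) *: v) => //.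
rewrite diff_val dfZ divfK//; apply/rowP => i.
by rewrite !mxE mulr1 ord1.
Qed.

(** Reading 4 as 3 + 1, the left block consists of x, y, z; it serves as a global linear equation of
    the t-axis. *)
Definition xyz (q : 'rV[C]_4) : 'rV[C]_3 := @lsubmx C 1 3 1 q.

Lemma is_diff_xyz p : is_diff p xyz xyz.
Proof.
exact: (@is_diff_lin _ _ _ (@lsubmx C 1 3 1) p (@continuous_lsubmx _ _ _ _)).
Qed.

Lemma xyz_eq0 p : xyz p = 0 <-> V2 R p.
Proof.
rewrite V2P; split=> [/rowP p0|[p0 p1 p2]].
  have E (i : 'I_3) : p 0 (lshift 1 i) = 0 by have := p0 i; rewrite !mxE.
  by split; [rewrite -[RHS](E 0)|rewrite -[RHS](E 1)|rewrite -[RHS](E 2)];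
    congr (p 0 _); exact: val_inj.
apply/rowP => -[[|[|[|//]]] hi]; rewrite !mxE;
  [rewrite -[RHS]p0|rewrite -[RHS]p1|rewrite -[RHS]p2];
  by congr (p 0 _); exact: val_inj.
Qed.

Lemma local_equation_V2 p : V2 R p -> local_equation (V2 R) p setT xyz.
Proof.
move=> hp; split => //; first exact: openT.
  by rewrite setIT setTI; apply/seteqP; split=> q /xyz_eq0.
move=> q _; have h := is_diff_xyz q; split; first exact: ex_diff.
apply/seteqP; split=> // u _; exists (row_mx u (0 : 'rV_1)) => //.
by rewrite diff_val /xyz row_mxKl.
Qed.

(* ('i x) ^ 6 = - x ^ 6, so the points (x, 'i x, 0, t) lie on V1. *)
Lemma V2_sub_closure : V2 R `<=` closure (V1 R `\` V2 R).
Proof.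
move=> _ [t _ <-] B pB.
have h : vec4 (k.+1%:R^-1) ('i * k.+1%:R^-1) 0 t @[k --> \oo] --> vec4 0 0 0 t.
  have h0 := @cvg_invSn_Cplx R.
  apply: cvg_vec4; [exact: h0| |exact: cvg_cst|exact: cvg_cst].
  by rewrite -[X in _ --> X](mulr0 ('i : C)); apply: cvgMr.
have /filter_ex[k Bk] : \forall k \near \oo,
  B (vec4 (k.+1%:R^-1) ('i * k.+1%:R^-1) 0 t) by exact: h.
exists (vec4 (k.+1%:R^-1) ('i * k.+1%:R^-1) 0 t); split=> //; split.
  have i6 : 'i ^+ 6 = -1 :> C by rewrite (exprM _ 2 3) sqrCi -signr_odd expr1.
  rewrite /V1/= /f !vec4E exprMn i6 mulN1r subrr.
  by rewrite !expr0n/= !(mulr0, mul0r, addr0).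
by move=> /V2P[]; rewrite vec4E => /eqP; rewrite invr_eq0 pnatr_eq0.
Qed.

Lemma whitney_pair_V : whitney_pair 3 1 (V1 R `\` V2 R) (V2 R).
Proof.
split.
- move=> p [_ hp]; exists 1, (~` V2 R), f_row; split=> //.
  exact: local_equation_V1.
- by move=> p hp; exists 3, setT, xyz; split=> //; exact: local_equation_V2.
- by apply/seteqP; split=> // p [[]].
- exact: V2_sub_closure.
Qed.

(** * The hyperplane dt = 0, the t-axis, and tangent spaces *)

Lemma hyperplane_free : frame C 3 4 (row_mx 1%:M 0 : 'M[C]_(3, 3 + 1)).
Proof. exact: (@row_free_mx10 C 3 1). Qed.

Lemma axis_free : frame C 1 4 (row_mx 0 1%:M : 'M[C]_(1, 3 + 1)).
Proof. exact: (@row_free_mx01 C 3 1). Qed.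

Definition hyperplane : grassmannian C 3 4 :=
  gr_span (SigSub (mem_set hyperplane_free)).
Definition axis : grassmannian C 1 4 := gr_span (SigSub (mem_set axis_free)).

Lemma mem_hyperplane v : v \in gr_space hyperplane <-> v 0 3 = 0.
Proof.
apply: iff_trans (@mem_row_span_mx10 C 3 1 v) _.
have -> : (3 : 'I_4) = rshift 3 (0 : 'I_1) by exact: val_inj.
split=> [/rowP/(_ 0)|v3]; first by rewrite !mxE.
by apply/rowP => i; rewrite !mxE ord1.
Qed.

Lemma mem_axis v : v \in gr_space axis <-> V2 R v.
Proof. by rewrite -xyz_eq0; exact: (@mem_row_span_mx01 C 3 1 v). Qed.

(* w = - 3 / (2 t) is the double root of 1 + t w + w ^ 3. *)
Lemma V3_double_root t : 4 * t ^+ 3 + 27 = 0 ->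
  exists2 w : C, t = - 3 * w ^+ 2 & 2 * w ^+ 3 = 1.
Proof.
move=> ht; have t0 : t != 0.
  by apply/eqP => t0; move/eqP: ht; rewrite t0 expr0n mulr0 add0r pnatr_eq0.
have e : t ^+ 3 = - 27 / 4.
  apply: (mulfI (_ : 4 != 0)); first by rewrite pnatr_eq0.
  by move/eqP: ht; rewrite addr_eq0 => /eqP ->; field.
exists (- 3 / (2 * t)); last first.
  by rewrite expr_div_n exprMn e; field.
(* By [e] the constant -27/4 is t^3, and t^3 / t^2 = t. *)
have -> : - 3 * (- 3 / (2 * t)) ^+ 2 = (- 27 / 4) / t ^+ 2 by field.
by rewrite -e; field.
Qed.

Lemma is_tangent_space_V1 p (T : {vspace 'rV[C]_4}) : ~ V2 R p ->
  (forall v, v \in T <-> df p v = 0) -> is_tangent_space (V1 R `\` V2 R) p T.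
Proof.
move=> hp hT; exists 1, (~` V2 R), f_row; split; first exact: local_equation_V1.
by have h := is_diff_f_row p => v; rewrite diff_val hT scale_const_mx1_eq0.
Qed.

Lemma is_tangent_space_V2 p : V2 R p -> is_tangent_space (V2 R) p axis.
Proof.
move=> hp; exists 3, setT, xyz; split; first exact: local_equation_V2.
by have h := is_diff_xyz p => v; rewrite diff_val mem_axis xyz_eq0.
Qed.

(** * The curve tending to a point of [V3], and the failure of both conditions *)

Section Curve.
Variables (w : C) (hw : 2 * w ^+ 3 = 1).
(** For this t the derivative t + 3 w^2 of the cubic vanishes, and the cubic itself becomes 1 - 2
    w^3, which is 0 by [hw]. *)
Let t : C := - 3 * w ^+ 2.

Let u (k : nat) : C := k.+1%:R^-1.

Let u_neq0 k : u k != 0.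
Proof. by rewrite invr_eq0 pnatr_eq0. Qed.

Let u0 : u @ \oo --> (0 : C).
Proof. exact: cvg_invSn_Cplx. Qed.

Definition parabola k : 'rV[C]_4 := vec4 (u k) 0 (w * u k ^+ 2) t.

Lemma parabola_V1 k : (V1 R `\` V2 R) (parabola k).
Proof.
split; last by case/V2P; rewrite vec4E => /eqP; rewrite (negPf (u_neq0 k)).
rewrite /V1/= /f !vec4E.
transitivity ((1 - 2 * w ^+ 3) * u k ^+ 6); first by rewrite /t; ring.
by rewrite hw subrr mul0r.
Qed.

Lemma parabola_cvg : parabola @ \oo --> vec4 0 0 0 t.
Proof.
apply: cvg_vec4; [exact: u0|exact: cvg_cst| |exact: cvg_cst].
rewrite -[X in _ --> X](mulr0 w) -[X in w * X](mulr0 (0 : C)).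
by apply: cvgMr; apply: cvgM.
Qed.

Lemma parabola_tangent k :
  is_tangent_space (V1 R `\` V2 R) (parabola k) hyperplane.
Proof.
apply: is_tangent_space_V1; first by case: (parabola_V1 k).
have w0 : w != 0.
  by apply/eqP => w0; move/eqP: hw; rewrite w0 expr0n mulr0 eq_sym oner_eq0.
move=> v; rewrite mem_hyperplane.
(* The z-derivative u^4 (t + 3 w^2) vanishes by the choice of t, and [hw] will remove the
   x-derivative; only the dt term is left. *)
have -> : df (parabola k) v =
    6 * u k ^+ 5 * (1 - 2 * w ^+ 3) * v 0 0 + u k ^+ 6 * w * v 0 3.
  by rewrite /df !vec4E /t; ring.
rewrite hw subrr mulr0 mul0r add0r; split=> [->|/eqP]; first by rewrite mulr0.
by rewrite mulf_eq0 (negPf (mulf_neq0 (expf_neq0 6 (u_neq0 k)) w0)) => /eqP.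
Qed.

Lemma not_whitney_a_V3 :
  ~ whitney_a 3 1 (V1 R `\` V2 R) (V2 R) (vec4 0 0 0 t).
Proof.
move=> /(_ parabola (fun=> hyperplane) hyperplane axis parabola_V1
  parabola_cvg parabola_tangent (cvg_cst _)) sub.
have : vec4 0 0 0 1 \in gr_space hyperplane.
  apply: subvP (sub _) _ _; first by apply: is_tangent_space_V2; exists t.
  by apply/mem_axis; exists 1.
by move=> /mem_hyperplane/eqP; rewrite vec4E oner_eq0.
Qed.

(** These rows are the secant directions divided by u. The entry 1 keeps them nonzero for every z,
    including the limit z = 0. *)
Lemma secant_free z : frame C 1 4 (vec4 1 0 z (- 1)).
Proof.
rewrite /frame/= /row_free rank_rV eqb1; apply/eqP => /(congr1 (fun v => v 0 0)).
by move=> /eqP; rewrite vec4E mxE oner_eq0.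
Qed.

Definition secant_frame z : frame C 1 4 := SigSub (mem_set (secant_free z)).

Lemma not_whitney_b_V3 :
  ~ whitney_b 3 (V1 R `\` V2 R) (V2 R) (vec4 0 0 0 t).
Proof.
pose q_ k : 'rV[C]_4 := vec4 0 0 0 (t + u k).
have q_V2 k : V2 R (q_ k) by exists (t + u k).
have q_cvg : q_ @ \oo --> vec4 0 0 0 t.
  apply: cvg_vec4; [exact: cvg_cst|exact: cvg_cst|exact: cvg_cst|].
  by rewrite -[X in _ --> X]addr0; apply: cvgD; [exact: cvg_cst|exact: u0].
pose l_ k := gr_span (secant_frame (w * u k)).
have l_secant k : l_ k = <[parabola k - q_ k]>%VS :> {vspace 'rV[C]_4}.
  have -> : parabola k - q_ k = u k *: vec4 1 0 (w * u k) (- 1).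
    rewrite [LHS]vec4_eta [RHS]vec4_eta !mxE/=; congr vec4; ring.
  (* A vector and its multiple by the nonzero scalar [u k] span the same line. *)
  rewrite /= row_span_rV; apply/eqP; rewrite eqEsubv -!memvE.
  rewrite memvZ ?memv_line// andbT; apply/vlineP; exists (u k)^-1.
  by rewrite scalerA mulVf// scale1r.
have l_cvg : l_ @ \oo --> gr_span (secant_frame 0).
  (* Convergence of the lines follows from that of the rescaled frames, whereas the differences
     themselves tend to 0. *)
  apply: continuous_cvg; first exact: gr_span_continuous.
  apply: cvg_frame; apply: cvg_vec4; try exact: cvg_cst.
  by rewrite -[X in _ --> X](mulr0 w); apply: cvgMr.
move=> /(_ parabola q_ (fun=> hyperplane) hyperplane l_ _ parabola_V1 q_V2
  parabola_cvg q_cvg parabola_tangent (cvg_cst _) l_secant l_cvg) sub.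
have : vec4 1 0 0 (- 1) \in gr_space hyperplane.
  by apply: subvP sub _ _; rewrite /= row_span_rV memv_line.
by move=> /mem_hyperplane/eqP; rewrite vec4E oppr_eq0 oner_eq0.
Qed.

End Curve.

End Example.

Theorem theorem3p4 (R : realType) :
  [/\ V2 R = singular_locus (f R),
      V3 R `<=` V2 R,
      whitney_pair 3 1 (V1 R `\` V2 R) (V2 R)
    & forall p : 'rV[Cplx R]_4, V3 R p ->
        ~ whitney_a 3 1 (V1 R `\` V2 R) (V2 R) p /\
        ~ whitney_b 3 (V1 R `\` V2 R) (V2 R) p].
Proof.
split; [exact: V2_singular_locus| |exact: whitney_pair_V|].
  by move=> _ [t _ <-]; exists t.
move=> _ [t /V3_double_root[w -> hw] <-].
by split; [exact: not_whitney_a_V3|exact: not_whitney_b_V3].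
Qed.
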